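(* Fix parameters $\varepsilon\in(0,1]$, $\alpha\in[0,1)$, $\xi>0$, and $\delta_0:=1/10$. Let $\hat p$ and $q$ be known distributions over $[n]$, let $p$ be an unknown distribution over $[n]$, and let $\eta:=d_{\rm TV}(\hat p,q)$. Then the algorithm Private-Augmented-Identity-Tester (described step by step in the context) is a $(\xi,\varepsilon,\alpha,\delta_0)$-private augmented identity tester which takes $s$ samples from $p$, where $$ s=\begin{cases} \Theta\left(\dfrac{\sqrt n}{\varepsilon^2}+\dfrac{\sqrt n}{\varepsilon\sqrt{\xi}}+\dfrac{n^{1/3}}{\varepsilon^{4/3}\xi^{2/3}}+\dfrac{1}{\varepsilon\xi}\right), & \eta\le\alpha,\\[2ex] \Theta\left(\min\left(\dfrac{1}{(\eta-\alpha)^2}+\dfrac{1}{(\eta-\alpha)\xi},\ \dfrac{\sqrt n}{\varepsilon^2}+\dfrac{\sqrt n}{\varepsilon\sqrt{\xi}}+\dfrac{n^{1/3}}{\varepsilon^{4/3}\xi^{2/3}}+\dfrac{1}{\varepsilon\xi}\right)\right), & \eta>\alpha. \end{cases}$$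
   Context: $[n]=\{1,\dots,n\}$. For distributions $p,q$ on $[n]$, $p(S)=\sum_{i\in S}p_i$ and $d_{\rm TV}(p,q)=\max_{S\subseteq[n]}|p(S)-q(S)|=\frac12\|p-q\|_1$. $\mathbf{Lap}(b)$ is a Laplace random variable with scale $b$ (mean zero). Differential privacy: for datasets $X,X'$, $\operatorname{Ham}(X,X')$ is the number of samples in which they differ. A randomized algorithm $\mathcal A$ is $\xi$-differentially private if for all $X,X'$ with $\operatorname{Ham}(X,X')=1$ and all sets $O$ of outputs, $\Pr[\mathcal A(X)\in O]\le e^{\xi}\Pr[\mathcal A(X')\in O]$. Private augmented identity tester: let $q$ (reference) and $\hat p$ (advice) be known distributions over $[n]$. A randomized algorithm $\mathcal A$ receiving i.i.d. samples from an unknown distribution $p$ over $[n]$ and returning a value in $\{\mathsf{accept},\mathsf{reject},\bot\}$ is a $(\xi,\varepsilon,\alpha,\delta)$-private augmented identity tester if: (1) $\mathcal A$ is $\xi$-differentially private (with respect to the samples); (2) if $p=q$, $\mathcal A$ outputs $\mathsf{reject}$ with probability at most $\delta$; (3) if $d_{\rm TV}(p,q)>\varepsilon$, $\mathcal A$ outputs $\mathsf{accept}$ with probability at most $\delta$; (4) if $d_{\rm TV}(p,\hat p)\le\alpha$, $\mathcal A$ outputs $\bot$ with probability at most $\delta$. Algorithm Private-Augmented-Identity-Tester (inputs: sample access to $p$; $q,\hat p,n,\varepsilon,\alpha,\xi$; $\delta=0.1$): 1. Compute $\eta=d_{\rm TV}(\hat p,q)$. 2. If $\eta\le\alpha$,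 or if $\frac{\sqrt n}{\varepsilon^2}+\frac{\sqrt n}{\varepsilon\sqrt{\xi}}+\frac{n^{1/3}}{\varepsilon^{4/3}\xi^{2/3}}+\frac{1}{\varepsilon\xi}\le\frac{1}{(\eta-\alpha)^2}+\frac{1}{(\eta-\alpha)\xi}$, run the known non-augmented $\xi$-differentially private identity tester of Acharya, Sun and Zhang (2018) and output its answer. (That tester, using $\Theta\big(\frac{\sqrt n}{\varepsilon^2}+\frac{\sqrt n}{\varepsilon\sqrt{\xi}}+\frac{n^{1/3}}{\varepsilon^{4/3}\xi^{2/3}}+\frac{1}{\varepsilon\xi}\big)$ samples from $p$, distinguishes $p=q$ from $d_{\rm TV}(p,q)>\varepsilon$ with error probability at most $0.1$.) 3. Otherwise, let $S=\{i\in[n]:\hat p_i<q_i\}$ and draw $s=\Theta\big(\frac{1}{(\eta-\alpha)^2}+\frac{1}{(\eta-\alpha)\xi}\big)$ samples $x_1,\dots,x_s$ from $p$. 4. Let $\sigma=\frac1s\sum_{j=1}^{s}\mathbf 1[x_j\in S]$ and $\hat\sigma=\sigma+\mathbf{Lap}\big(\frac{1}{s\xi}\big)$. 5. If $|\hat\sigma-q(S)|>\frac{\eta-\alpha}{4}$, return $\mathsf{reject}$; else return $\bot$. *)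

(* Defs.v *)
From HB Require Import structures.
From mathcomp Require Import all_boot all_order all_algebra.
From mathcomp Require Import all_classical all_reals all_analysis.
From mathcomp Require Import measurable_realfun.

Set Implicit Arguments.
Unset Strict Implicit.
Unset Printing Implicit Defensive.

Import Order.TTheory GRing.Theory Num.Theory.
Import numFieldNormedType.Exports.

Local Open Scope classical_set_scope.
Local Open Scope ring_scope.

Section laplace.
Context {R : realType}.
Notation mu := (@lebesgue_measure R).

Definition laplace_pdf (b x : R) : R := (2 * b)^-1 * expR (- (`|x| / b)).

(* Total in [b]: for [b <= 0] it is the point mass at 0. *)
Definition laplace_prob (b : R) : set (measurableTypeR R) -> \bar R :=
  if 0 < b then fun A => (\int[mu]_(x in A) (laplace_pdf b x)%:E)%E
  else dirac (0 : measurableTypeR R).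

Lemma laplace_pdf_ge0 b x : 0 < b -> 0 <= laplace_pdf b x.
Proof. by move=> b0; rewrite mulr_ge0 ?expR_ge0// invr_ge0 mulr_ge0// ltW. Qed.

Lemma continuous_laplace_pdf b : continuous (laplace_pdf b).
Proof.
move=> x; apply: cvgM; first exact: cvg_cst.
apply: (cvg_comp _ expR); last exact: continuous_expR.
apply: (@cvgN _ R^o); apply: cvgM; last exact: cvg_cst.
exact: norm_continuous.
Qed.

Lemma measurable_laplace_pdf b : measurable_fun [set: R] (laplace_pdf b).
Proof. by apply: continuous_measurable_fun; exact: continuous_laplace_pdf. Qed.

Lemma integral_laplace_pdf b : 0 < b ->
  (\int[mu]_x (laplace_pdf b x)%:E = 1)%E.
Proof.
move=> b0; have bi0 : 0 < b^-1 by rewrite invr_gt0.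
rewrite ge0_symfun_integralT; last 3 first.
- by move=> x; exact: laplace_pdf_ge0.
- exact: continuous_laplace_pdf.
- by move=> x /=; rewrite /laplace_pdf normrN.
have e1 := integral_exponential_pdf bi0.
have mE : measurable_fun [set: R] (EFin \o exponential_pdf b^-1).
  by apply/measurable_EFinP; exact: measurable_exponential_pdf.
have {}e1 : (\int[mu]_(x in [set x | (0 <= x)%R]) (exponential_pdf b^-1 x)%:E = 1)%E.
  rewrite -e1 [RHS]integral_mkcond/= integral_mkcond/=.
  apply: eq_integral => x _; rewrite !patchE in_setT.
  case: ifPn => //; rewrite notin_setE/= => /negP; rewrite -ltNge => x0.
  by rewrite lt0_exponential_pdf.
have m0 : measurable [set x : R | 0 <= x].
  by rewrite -set_itvcy; exact: measurable_itv.
transitivity (2%:E * (2^-1%:E * \int[mu]_(x in [set x | (0 <= x)%R])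
    (exponential_pdf b^-1 x)%:E))%E.
  congr (_ * _)%E; rewrite -ge0_integralZl//=.
  - apply: eq_integral => x; rewrite inE/= => x0.
    rewrite exponential_pdfE// -EFinM; congr EFin.
    by rewrite /laplace_pdf ger0_norm// invfM mulrA mulNr (mulrC x).
  - exact: measurable_funTS.
  - by move=> x _; rewrite lee_fin exponential_pdf_ge0// ltW.
by rewrite e1 mule1 -EFinM divff.
Qed.

Variable b : R.
Local Notation lap := (laplace_prob b).

Let lap0 : lap set0 = 0%E.
Proof.
by rewrite /laplace_prob; case: ifP => _; rewrite ?integral_set0 ?measure0.
Qed.

Let lap_ge0 A : (0 <= lap A)%E.
Proof.
rewrite /laplace_prob; case: ifPn => // b0.
by apply: integral_ge0 => x _; rewrite lee_fin laplace_pdf_ge0.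
Qed.

Let lap_sigma_additive : semi_sigma_additive lap.
Proof.
rewrite /laplace_prob; case: ifPn => b0; last exact: measure_semi_sigma_additive.
move=> /= F mF tF mUF; apply: cvg_toP.
  apply: ereal_nondecreasing_is_cvgn => m n mn.
  apply: lee_sum_nneg_natr => // k _ _; apply: integral_ge0 => /= x Fkx.
  by rewrite lee_fin laplace_pdf_ge0.
rewrite ge0_integral_bigcup//=.
- apply/measurable_funTS/measurableT_comp => //.
  exact: measurable_laplace_pdf.
- by move=> x _; rewrite lee_fin laplace_pdf_ge0.
Qed.

HB.instance Definition _ := isMeasure.Build _ _ _
  lap lap0 lap_ge0 lap_sigma_additive.

Let lap_setT : lap [set: _] = 1%E.
Proof.
rewrite /laplace_prob; case: ifPn => b0; last by rewrite diracT.
exact: integral_laplace_pdf.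
Qed.

HB.instance Definition _ :=
  @Measure_isProbability.Build _ _ R lap lap_setT.

End laplace.

Section finite_distributions.
Context {R : realType} {n : nat}.

(* ['I_n] stands for [n]; [fdist R 0] is empty. *)
Record fdist := Fdist {
  pmf :> 'I_n -> R ;
  pmf_ge0 : forall i, 0 <= pmf i ;
  pmf_sum1 : \sum_i pmf i = 1 }.

Definition mass (p : fdist) (S : {set 'I_n}) : R := \sum_(i in S) p i.

Definition dTV (p q : fdist) : R :=
  \big[Num.max/0]_(S : {set 'I_n}) `|mass p S - mass q S|.

End finite_distributions.
Arguments fdist : clear implicits.

Section randomized_algorithms.
Context {R : realType}.

(* A randomized algorithm draws [nsamples] samples and, independently, a seed
   that carries its internal randomness.  [T] is thought of as discrete, whence
   the measurability requirement on all [O : set T]. *)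
Record rand_alg (n : nat) (T : Type) := RandAlg {
  nsamples : nat ;
  seed_disp : measure_display ;
  seed : measurableType seed_disp ;
  seed_law : probability seed R ;
  run : nsamples.-tuple 'I_n -> seed -> T ;
  run_measurable : forall X (O : set T), measurable (run X @^-1` O) }.

Context {n : nat} {T : Type}.
Implicit Type A : rand_alg n T.

Definition out_prob A (X : (nsamples A).-tuple 'I_n) (O : set T) : R :=
  fine (seed_law A (run X @^-1` O)).

(* The same probability when the samples are drawn i.i.d. from [p]. *)
Definition iid_prob A (p : fdist R n) (O : set T) : R :=
  \sum_(X : (nsamples A).-tuple 'I_n)
    (\prod_(j < nsamples A) p (tnth X j)) * out_prob X O.

Definition Ham (s : nat) (X X' : s.-tuple 'I_n) : nat :=
  #|[set j | tnth X j != tnth X' j]|.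

Definition private (xi : R) A : Prop :=
  forall X X' : (nsamples A).-tuple 'I_n, Ham X X' = 1%N ->
  forall O : set T, out_prob X O <= expR xi * out_prob X' O.

End randomized_algorithms.
Arguments rand_alg : clear implicits.

Inductive verdict := Accept | Reject | Bot.

(* For a tester without advice, [true] means accept and [false] reject. *)
Definition verdict_of_bool (b : bool) : verdict := if b then Accept else Reject.

Section testers.
Context {R : realType} {n : nat}.

Definition private_identity_tester (q : fdist R n) (xi eps delta : R)
    (A : rand_alg R n bool) : Prop :=
  [/\ private xi A,
      forall p : fdist R n, p = q -> iid_prob A p [set false] <= delta &
      forall p : fdist R n, eps < dTV p q -> iid_prob A p [set true] <= delta].

Definition private_augmented_identity_tester (q phat : fdist R n)
    (xi eps alpha delta : R) (A : rand_alg R n verdict) : Prop :=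
  [/\ private xi A,
      forall p : fdist R n, p = q -> iid_prob A p [set Reject] <= delta,
      forall p : fdist R n, eps < dTV p q -> iid_prob A p [set Accept] <= delta &
      forall p : fdist R n, dTV p phat <= alpha ->
        iid_prob A p [set Bot] <= delta].

End testers.

Section sample_complexities.
Context {R : realType}.

Definition plain_rate (n : nat) (eps xi : R) : R :=
  Num.sqrt n%:R / eps ^+ 2 + Num.sqrt n%:R / (eps * Num.sqrt xi)
  + (n%:R `^ (1 / 3)) / ((eps `^ (4 / 3)) * (xi `^ (2 / 3))) + 1 / (eps * xi).

(* [gap] is eta - alpha. *)
Definition advice_rate (gap xi : R) : R := 1 / gap ^+ 2 + 1 / (gap * xi).

Definition augmented_rate (n : nat) (eta eps alpha xi : R) : R :=
  if eta <= alpha then plain_rate n eps xi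
  else Num.min (advice_rate (eta - alpha) xi) (plain_rate n eps xi).

End sample_complexities.

Section algorithm.
Context {R : realType}.

(* The non-augmented tester used as a subroutine, for every [n], [q], [eps],
   [xi], with its guarantee; [c] and [C] are the constants hidden in the Theta
   of its sample complexity. *)
Definition plain_tester_family :=
  forall n : nat, fdist R n -> R -> R -> rand_alg R n bool.

Definition plain_tester_spec (c C : R) (T0 : plain_tester_family) : Prop :=
  forall (n : nat) (q : fdist R n) (eps xi : R), 0 < eps <= 1 -> 0 < xi ->
    private_identity_tester q xi eps (1 / 10) (T0 n q eps xi) /\
    c * plain_rate n eps xi <= (nsamples (T0 n q eps xi))%:R
      <= C * plain_rate n eps xi.

(* [m gap xi] is the number of samples drawn when the advice is used; [k] and
   [K] are the constants hidden in its Theta.  As [1 <= advice_rate gap xi] on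
   this range, rounding up [k * advice_rate gap xi] gives such an [m] with
   [K = k + 1]. *)
Definition advice_size_spec (k K : R) (m : R -> R -> nat) : Prop :=
  forall gap xi : R, 0 < gap <= 1 -> 0 < xi ->
    k * advice_rate gap xi <= (m gap xi)%:R <= K * advice_rate gap xi.

Section map_output.
Variables (n : nat) (T U : Type) (f : T -> U) (A : rand_alg R n T).

Definition map_run (X : (nsamples A).-tuple 'I_n) (w : seed A) : U :=
  f (run X w).

Lemma map_run_measurable X (O : set U) : measurable (map_run X @^-1` O).
Proof. exact: (run_measurable X (f @^-1` O)). Qed.

Definition map_output : rand_alg R n U :=
  RandAlg (seed_law A) map_run_measurable.

End map_output.

Section advice_test.
Variables (n : nat) (q phat : fdist R n) (alpha xi : R) (s : nat).

Let eta := dTV phat q.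
Let S : {set 'I_n} := [set i | phat i < q i].

Definition advice_freq (X : s.-tuple 'I_n) : R :=
  s%:R^-1 * \sum_(j < s) (tnth X j \in S)%:R.

Definition advice_run (X : s.-tuple 'I_n) (noise : measurableTypeR R) : verdict :=
  if (eta - alpha) / 4 < `|advice_freq X + noise - mass q S|
  then Reject else Bot.

Lemma advice_run_measurable X (O : set verdict) :
  measurable (advice_run X @^-1` O).
Proof.
pose B : set (measurableTypeR R) :=
  [set w | (eta - alpha) / 4 < `|advice_freq X + w - mass q S|].
have mB : measurable B.
  have mf : measurable_fun [set: measurableTypeR R]
      (fun w : R => `|advice_freq X + w - mass q S|).
    apply: measurableT_comp => //.
    by apply: measurable_funB => //; exact: measurable_funD.
  rewrite (_ : B = setT `&`
    (fun w : R => `|advice_freq X + w - mass q S|) @^-1` `](eta - alpha) / 4, +oo[).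
    exact: mf.
  by rewrite setTI; apply/seteqP; split => w /=; rewrite in_itv/= andbT.
have -> : advice_run X @^-1` O =
    (B `&` [set _ | O Reject]) `|` (~` B `&` [set _ | O Bot]).
  apply/seteqP; split => w; rewrite /B /advice_run /=.
    by case: ifPn => [? ?|/negP ? ?]; [left|right].
  by case=> -[]; [move=> -> | move=> /negP/negbTE ->].
have mcst (P : Prop) : measurable [set _ : measurableTypeR R | P].
  have [p|np] := pselect P.
    by rewrite (_ : [set _ | _] = setT)//; apply/seteqP; split.
  by rewrite (_ : [set _ | _] = set0)//; apply/seteqP; split.
by apply: measurableU; apply: measurableI => //; exact: measurableC.
Qed.

Definition advice_test : rand_alg R n verdict :=
  RandAlg (laplace_prob (1 / (s%:R * xi))) advice_run_measurable.

End advice_test.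

Definition augmented_tester (T0 : plain_tester_family) (m : R -> R -> nat)
    (n : nat) (q phat : fdist R n) (eps alpha xi : R) : rand_alg R n verdict :=
  let eta := dTV phat q in
  if (eta <= alpha)
     || (plain_rate n eps xi <= advice_rate (eta - alpha) xi)
  then map_output verdict_of_bool (T0 n q eps xi)
  else advice_test q phat alpha xi (m (eta - alpha) xi).

End algorithm.

(* Main.v *)
Require Import Defs.
From mathcomp Require Import all_boot all_order all_algebra.
From mathcomp Require Import all_classical all_reals all_analysis.
From mathcomp Require Import measurable_realfun ring lra.

Set Implicit Arguments.
Unset Strict Implicit.
Unset Printing Implicit Defensive.

Import Order.TTheory GRing.Theory Num.Theory.
Local Open Scope ring_scope.

(* The set S maximizes q - phat, so [q S - phat S = eta]. When [p = q], the
   frequency of S in the samples is centered at [q S]; when p is within alpha of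
   phat, it is centered at distance at least [gap = eta - alpha] from [q S].
   Hence the test on [|freq + noise - q S| > gap / 4] errs only if the frequency
   (Chebyshev) or the Laplace noise (tail bound) deviates by more than [gap / 8];
   with s samples this has probability at most
   [64 / (s * gap ^+ 2) + 32 / (s * gap * xi)]. Changing one sample moves the
   frequency by at most [1 / s], and translating the Laplace law of scale
   [1 / (s * xi)] by [1 / s] costs a factor of at most [expR xi]. *)

(** * Translates and tails of the Laplace law *)

Section laplace_estimates.
Context {R : realType}.
Local Open Scope classical_set_scope.
Notation mu := (@lebesgue_measure R).
Implicit Types (A : set (measurableTypeR R)) (b d t : R).

(** Translation preserves the length of half-open intervals, and this determines Lebesgue
    measure. *)
Lemma lebesgue_measureD d A : measurable A ->
  pushforward mu ((fun x => x + d) : _ -> measurableTypeR R) A = mu A.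
Proof.
move=> mA; apply/esym/lebesgue_measure_unique => //=.
  by apply: measurable_funD.
move=> mD _ [[a b]] _ <-; rewrite /pushforward.
rewrite (_ : _ @^-1` _ = `](a - d), (b - d)]%classic); last first.
  by apply/seteqP; split=> x; rewrite /= !in_itv/= ltrBlDr lerBrDr.
by rewrite !lebesgue_measure_itv/= !lte_fin ltrD2r -!EFinB opprB addrA subrK.
Qed.

Lemma laplace_probE b A : 0 < b ->
  laplace_prob b A = (\int[mu]_(x in A) (laplace_pdf b x)%:E)%E.
Proof. by rewrite /laplace_prob => ->. Qed.

Lemma measurable_EFin_laplace_pdf b D :
  measurable_fun D (EFin \o @laplace_pdf R b).
Proof.
by apply: measurable_funTS; apply/measurable_EFinP; exact: measurable_laplace_pdf.
Qed.

Lemma laplace_pdf_shift b d x : 0 < b ->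
  laplace_pdf b x <= expR (`|d| / b) * laplace_pdf b (x + d).
Proof.
move=> b0; rewrite /laplace_pdf mulrCA ler_pM2l ?invr_gt0 ?mulr_gt0//.
rewrite -expRD ler_expR -!mulNr -mulrDl ler_pM2r ?invr_gt0//.
by have := ler_normD x d; lra.
Qed.

(** A change of variables puts both integrals over the translated set, where [laplace_pdf_shift]
    compares the integrands pointwise. *)
Lemma laplace_prob_shift b d A : 0 < b -> measurable A ->
  (laplace_prob b ((fun x => (x + d)%R) @^-1` A)
    <= (expR (`|d| / b))%:E * laplace_prob b A)%E.
Proof.
move=> b0 mA; rewrite !laplace_probE//.
have mshift : measurable_fun setT ((fun x => x + d) : R -> measurableTypeR R).
  by apply: measurable_funD.
have mA' : measurable ((fun x => x + d) @^-1` A : set R).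
  by rewrite -[X in measurable X]setTI; exact: mshift.
have -> : (\int[mu]_(x in A) (laplace_pdf b x)%:E =
    \int[mu]_(x in (fun x => (x + d)%R) @^-1` A) (laplace_pdf b (x + d))%:E)%E.
  transitivity (\int[pushforward mu ((fun x => (x + d)%R) : R -> measurableTypeR R)]_(x in A)
      (laplace_pdf b x)%:E)%E.
    by apply: eq_measure_integral => //= B mB _; exact/esym/lebesgue_measureD.
  rewrite ge0_integral_pushforward//=.
    exact: measurable_EFin_laplace_pdf.
  by move=> x _; rewrite lee_fin laplace_pdf_ge0.
have mpdf : measurable_fun ((fun x => x + d) @^-1` A)
    (fun x : R => (laplace_pdf b (x + d))%:E).
  apply: measurable_funTS.
  exact: (measurableT_comp (@measurable_EFin_laplace_pdf b setT) mshift).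
rewrite -ge0_integralZl ?lee_fin ?expR_ge0//; last first.
  by move=> x _; rewrite lee_fin laplace_pdf_ge0.
apply: ge0_le_integral => //.
- by move=> x _; rewrite lee_fin laplace_pdf_ge0.
- exact: measurable_EFin_laplace_pdf.
- exact: measurable_funeM.
- by move=> x _; rewrite -EFinM lee_fin laplace_pdf_shift.
Qed.

Lemma measurable_norm_gt t : measurable [set x : measurableTypeR R | t < `|x|].
Proof.
have mn : measurable_fun setT (fun x : measurableTypeR R => `|x|).
  exact: normr_measurable.
rewrite (_ : [set _ | _] = setT `&` (fun x : R => `|x|) @^-1` `]t, +oo[).
  exact: mn.
by rewrite setTI; apply/seteqP; split => w /=; rewrite in_itv/= andbT.
Qed.

Lemma expRN_le_inv (x : R) : 0 < x -> expR (- x) <= x^-1.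
Proof.
move=> x0; rewrite expRN lef_pV2 ?posrE ?expR_gt0//.
by apply: le_trans (expR_ge1Dx x); rewrite lerDr.
Qed.

(* Beyond [t] the density of scale [b] is at most [2 * expR (- t / (2 * b))]
   times the density of scale [2 * b], so the tail needs no primitive. *)
Lemma laplace_prob_tail b t : 0 < b -> 0 < t ->
  (laplace_prob b [set x | (t < `|x|)%R] <= (4 * b / t)%:E)%E.
Proof.
move=> b0 t0; rewrite laplace_probE//; have b20 : 0 < 2 * b by rewrite mulr_gt0.
pose c := 4 * b / t.
have c0 : 0 <= c by rewrite divr_ge0 ?mulr_ge0 ?ltW.
apply: (@le_trans _ _ (\int[mu]_(x in [set x | (t < `|x|)%R])
    (c%:E * (laplace_pdf (2 * b) x)%:E))%E).
  apply: ge0_le_integral => //.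
  - exact: measurable_norm_gt.
  - by move=> x _; rewrite lee_fin laplace_pdf_ge0.
  - exact: measurable_EFin_laplace_pdf.
  - by apply: measurable_funeM; exact: measurable_EFin_laplace_pdf.
  move=> x /= tx; rewrite -EFinM lee_fin /laplace_pdf.
  have -> : expR (- (`|x| / b))
      = expR (- (`|x| / (2 * b))) * expR (- (`|x| / (2 * b))).
    by rewrite -expRD; congr expR; field; rewrite gt_eqF.
  have xb : 0 < `|x| / (2 * b) by rewrite divr_gt0// (lt_trans t0).
  apply: (@le_trans _ _ ((2 * b)^-1 *
      ((t / (2 * b))^-1 * expR (- (`|x| / (2 * b)))))).
    rewrite ler_pM2l ?invr_gt0// ler_pM2r ?expR_gt0//.
    apply: le_trans (expRN_le_inv xb) _.
    by rewrite lef_pV2 ?posrE ?(divr_gt0 t0)// ler_pM2r ?invr_gt0 ?ltW.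
  rewrite le_eqVlt; apply/orP; left; apply/eqP; rewrite /c; field.
  by rewrite !gt_eqF.
rewrite ge0_integralZl//; last first.
- by move=> x _; rewrite lee_fin laplace_pdf_ge0.
- exact: measurable_EFin_laplace_pdf.
- exact: measurable_norm_gt.
rewrite -[leRHS]mule1; apply: lee_wpmul2l; first by rewrite lee_fin.
rewrite -laplace_probE//; apply: probability_le1; exact: measurable_norm_gt.
Qed.

End laplace_estimates.

(** * Second moments of sums of i.i.d. samples *)

Section iid_sums.
Context {R : realType}.

(** Distributivity, with tuples reindexed as finite functions; it makes expectations under the
    product law factor over coordinates. *)
Lemma sum_tuple_prod (T : finType) (s : nat) (h : 'I_s -> T -> R) :
  \sum_(X : s.-tuple T) \prod_(j < s) h j (tnth X j) = \prod_(j < s) \sum_x h j x.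
Proof.
rewrite bigA_distr_bigA (reindex (@finfun_of_tuple T s)); last first.
  apply: onW_bij; exists (@tuple_of_finfun T s).
    exact: finfun_of_tupleK.
  exact: tuple_of_finfunK.
by apply: eq_bigr => X _; apply: eq_bigr => j _; rewrite ffunE.
Qed.

Variables (n : nat) (p : fdist R n) (s : nat).

Definition iid_law (X : s.-tuple 'I_n) : R := \prod_(j < s) p (tnth X j).

Lemma iid_law_ge0 X : 0 <= iid_law X.
Proof. by apply: prodr_ge0 => j _; exact: Defs.pmf_ge0. Qed.

Lemma iid_law_sum1 : \sum_X iid_law X = 1.
Proof. by rewrite (sum_tuple_prod (fun=> p)) big1// => j _; exact: pmf_sum1. Qed.

Variable f : 'I_n -> R.
Hypothesis f_centered : \sum_i p i * f i = 0.

Lemma iid_covariance (i j : 'I_s) :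
  \sum_X iid_law X * (f (tnth X i) * f (tnth X j))
    = if i == j then \sum_x p x * f x ^+ 2 else 0.
Proof.
(* Coordinate [k] carries its own weight and whichever of the two factors read it; coordinates other
   than [i] and [j] then sum to 1. *)
pose h (k : 'I_s) x : R :=
  p x * ((if k == i then f x else 1) * (if k == j then f x else 1)).
transitivity (\sum_(X : s.-tuple 'I_n) \prod_(k < s) h k (tnth X k)).
  apply: eq_bigr => X _; rewrite !big_split/=; congr (_ * (_ * _)).
    by rewrite -big_mkcond big_pred1_eq.
  by rewrite -big_mkcond big_pred1_eq.
rewrite sum_tuple_prod (bigD1 i)//=.
have [ij|ij] := eqVneq i j.
  rewrite [X in _ * X]big1 ?mulr1; last first.
    move=> k ki; rewrite -[RHS](pmf_sum1 p); apply: eq_bigr => x _.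
    by rewrite /h -ij (negPf ki) !mulr1.
  by rewrite /=; apply: eq_bigr => x _; rewrite /h -ij eqxx expr2.
have -> : \sum_x h i x = 0; last by rewrite mul0r.
by rewrite -[RHS]f_centered; apply: eq_bigr => x _; rewrite /h eqxx (negPf ij) mulr1.
Qed.

(** Distinct samples are uncorrelated, so only the diagonal of the expanded square survives. *)
Lemma iid_variance :
  \sum_X iid_law X * (\sum_(j < s) f (tnth X j)) ^+ 2
    = s%:R * \sum_x p x * f x ^+ 2.
Proof.
transitivity (\sum_(i < s) \sum_(j < s) \sum_X
    iid_law X * (f (tnth X i) * f (tnth X j))).
  under [RHS]eq_bigr do rewrite exchange_big/=.
  rewrite exchange_big/=; apply: eq_bigr => X _.
  rewrite expr2 mulr_suml mulr_sumr; apply: eq_bigr => i _.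
  by rewrite mulr_sumr mulr_sumr.
rewrite (eq_bigr (fun=> \sum_x p x * f x ^+ 2)).
  by rewrite sumr_const card_ord mulr_natl.
move=> i _; under eq_bigr do rewrite iid_covariance eq_sym.
by rewrite -big_mkcond big_pred1_eq.
Qed.

End iid_sums.

(** * Output probabilities under i.i.d. sampling *)

Lemma out_prob_fin_num (R : realType) n T (A : rand_alg R n T) X O :
  seed_law A (run X @^-1` O)%classic \is a fin_num.
Proof. exact/fin_num_measure/run_measurable. Qed.

Lemma out_prob_le1 (R : realType) n T (A : rand_alg R n T) X O :
  out_prob (A := A) X O <= 1.
Proof.
rewrite /out_prob -lee_fin fineK ?out_prob_fin_num//.
exact/probability_le1/run_measurable.
Qed.

Lemma iid_prob_eq0 (R : realType) n T (A : rand_alg R n T) p O :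
  (forall (X : (nsamples A).-tuple 'I_n) w, ~ O (run X w)) -> iid_prob A p O = 0.
Proof.
move=> AO; rewrite /iid_prob big1// => X _.
rewrite /out_prob (_ : _ @^-1` _ = set0)%classic ?measure0/= ?mulr0//.
by apply/seteqP; split=> // w /AO.
Qed.

(* Chebyshev's inequality for the sample mean of [f]. *)
Lemma iid_prob_le (R : realType) n T (A : rand_alg R n T) (p : fdist R n)
    (O : set T) (f : 'I_n -> R) (t tau : R) (s := nsamples A) :
  (0 < s)%N -> 0 < t -> 0 <= tau ->
  \sum_i p i * f i = 0 -> \sum_i p i * f i ^+ 2 <= 1 ->
  (forall X : s.-tuple 'I_n,
     `|s%:R^-1 * \sum_(j < s) f (tnth X j)| <= t -> out_prob X O <= tau) ->
  iid_prob A p O <= (s%:R * t ^+ 2)^-1 + tau.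
Proof.
move=> s0 t0 tau0 f0 f1 devO; have s0' : 0 < s%:R :> R by rewrite ltr0n.
pose c := (s%:R^-1 * t^-1) ^+ 2.
have c0 : 0 <= c by rewrite sqr_ge0.
(* For each [X], either the mean deviates by at most [t] and [tau] suffices, or the term with [c]
   exceeds 1, a bound on any probability. *)
apply: (@le_trans _ _ (\sum_(X : s.-tuple 'I_n) (iid_law p X *
    (c * (\sum_(j < s) f (tnth X j)) ^+ 2 + tau)))).
  apply: ler_sum => X _; apply: ler_wpM2l; first exact: iid_law_ge0.
  have [/devO/le_trans->//|tX] := leP `|s%:R^-1 * \sum_(j < s) f (tnth X j)| t.
    by rewrite lerDr mulr_ge0// sqr_ge0.
  apply: le_trans (out_prob_le1 _ _) _; rewrite ler_wpDr//.
  rewrite /c -exprMn mulrAC -[leLHS](expr1n _ 2) -[leRHS]real_normK ?num_real//.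
  by rewrite ler_sqr ?nnegrE// normrM (gtr0_norm (_ : 0 < t^-1)) ?invr_gt0//
    ler_pdivlMr// mul1r ltW.
under eq_bigr do rewrite mulrDr mulrCA.
rewrite big_split/= -mulr_sumr -mulr_suml iid_law_sum1 mul1r lerD2r.
rewrite iid_variance//.
apply: (@le_trans _ _ (c * (s%:R * 1))).
  by rewrite ler_wpM2l// ler_wpM2l.
rewrite le_eqVlt; apply/orP; left; apply/eqP; rewrite /c; field.
by rewrite !gt_eqF.
Qed.

(** * Total variation distance *)

Section total_variation.
Context {R : realType} {n : nat}.
Implicit Types p q : fdist R n.

Lemma mass_ge0 p (S : {set 'I_n}) : 0 <= mass p S.
Proof. by apply: sumr_ge0 => i _; exact: Defs.pmf_ge0. Qed.

Lemma mass_setC p (S : {set 'I_n}) : mass p (~: S) = 1 - mass p S.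
Proof.
rewrite -(Defs.pmf_sum1 p) (bigID [in S])/= addrAC subrr add0r.
by apply: eq_bigl => i; rewrite inE.
Qed.

Lemma mass_le1 p (S : {set 'I_n}) : mass p S <= 1.
Proof. by rewrite -subr_ge0 -mass_setC mass_ge0. Qed.

Lemma mass_le_dTV p q S : `|mass p S - mass q S| <= dTV p q.
Proof. exact: (Order.TotalTheory.le_bigmax _ (fun S => `|mass p S - mass q S|)). Qed.

Lemma dTV_le1 p q : dTV p q <= 1.
Proof.
apply: Order.POrderTheory.bigmax_le => // S _.
have := (mass_ge0 p S, mass_ge0 q S, mass_le1 p S, mass_le1 q S).
by move=> [[[? ?] ?] ?]; rewrite ler_norml; apply/andP; split; lra.
Qed.

(** [S] collects exactly the points that contribute positively to [q - p], so no set gains more;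
    complements handle the opposite sign. *)
Lemma dTV_attained p q (S := [set i | p i < q i]) :
  dTV p q <= mass q S - mass p S.
Proof.
have gain (U : {set 'I_n}) : mass q U - mass p U <= mass q S - mass p S.
  rewrite /mass -!sumrB [leLHS]big_mkcond [leRHS]big_mkcond/=; apply: ler_sum => i _.
  by rewrite inE; case: ifP; case: ltP; lra.
apply: Order.POrderTheory.bigmax_le => [|U _].
  by have := gain finset.set0; rewrite /mass !big_set0 subrr.
have := gain U; have := gain (~: U); rewrite !mass_setC ler_norml.
by move=> ? ?; apply/andP; split; lra.
Qed.

End total_variation.

(** * Privacy and error of the advice test *)

Section advice_test_guarantees.
Context {R : realType} {n : nat}.
Variables (q phat : fdist R n) (alpha xi : R) (s : nat).
Let S := [set i | phat i < q i].
Let gap := dTV phat q - alpha.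

Hypothesis xi_gt0 : 0 < xi.
Hypothesis s_gt0 : (0 < s)%N.

Let s_gt0' : 0 < s%:R :> R. Proof. by rewrite ltr0n. Qed.

Let scale_gt0 : 0 < 1 / (s%:R * xi).
Proof. by rewrite divr_gt0// mulr_gt0. Qed.

Lemma advice_freq_Ham (X X' : s.-tuple 'I_n) :
  `|advice_freq q phat X - advice_freq q phat X'| <= (Ham X X')%:R / s%:R.
Proof.
rewrite /advice_freq -mulrBr -sumrB normrM gtr0_norm ?invr_gt0// mulrC.
rewrite ler_pM2r ?invr_gt0// (le_trans (ler_norm_sum _ _ _))//.
rewrite /Ham -sum1_card natr_sum [leRHS]big_mkcond/=; apply: ler_sum => j _.
case: ifPn => [_|].
  by do 2!case: (_ \in _); rewrite ?subrr ?subr0 ?sub0r ?normrN ?normr0 ?normr1.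
move=> /asboolPn/= /negP; rewrite negbK => /eqP ->.
by rewrite subrr normr0.
Qed.

Lemma advice_test_private : private xi (advice_test q phat alpha xi s).
Proof.
move=> X X' XX' O; set A := advice_test _ _ _ _ _ in X X' XX' *.
have mX' := run_measurable X' O.
pose d := advice_freq q phat X - advice_freq q phat X'.
(* The verdict depends only on frequency plus noise, so replacing [X'] by [X] amounts to translating
   the noise by [d]. *)
have preimE : (run X @^-1` O = (fun w => w + d) @^-1` (run X' @^-1` O))%classic.
  apply/seteqP; split=> w /=; rewrite /advice_run /d.
    by rewrite (addrC w) addrA addrCA subrr addr0.
  by rewrite (addrC w) addrA addrCA subrr addr0.
rewrite -lee_fin EFinM /out_prob !fineK ?out_prob_fin_num// preimE.
apply: le_trans (laplace_prob_shift _ scale_gt0 mX') _.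
apply: lee_wpmul2r; first exact: measure_ge0.
rewrite lee_fin ler_expR div1r invrK mulrA ger_pMl// -ler_pdivlMr//.
by have := advice_freq_Ham X X'; rewrite XX'.
Qed.

(** Shared by both error bounds: the last hypothesis says that, once the frequency is accurate, only
    large noise can produce a verdict in [O]. *)
Lemma advice_test_error (p : fdist R n) (O : set verdict) :
  0 < gap -> 1000 * advice_rate gap xi <= s%:R ->
  (forall (X : s.-tuple _) w, `|advice_freq q phat X - mass p S| <= gap / 8 ->
     O (advice_run q phat alpha X w) -> gap / 8 < `|w|) ->
  iid_prob (advice_test q phat alpha xi s) p O <= 1 / 10.
Proof.
move=> gap0 ssz noisy.
have t0 : 0 < gap / 8 by rewrite divr_gt0.
pose f i : R := (i \in S)%:R - mass p S.
have massE : \sum_i p i * (i \in S)%:R = mass p S.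
  rewrite /mass [RHS]big_mkcond/=; apply: eq_bigr => i _.
  by case: (i \in S); rewrite ?mulr1 ?mulr0.
apply: le_trans (@iid_prob_le _ _ _ (advice_test q phat alpha xi s) p O f
  (gap / 8) (4 * (1 / (s%:R * xi)) / (gap / 8)) _ _ _ _ _ _) _ => //=.
- by rewrite ltW// divr_gt0// mulr_gt0.
- rewrite /f; under eq_bigr do rewrite mulrBr.
  by rewrite sumrB massE -mulr_suml Defs.pmf_sum1 mul1r subrr.
- rewrite -(Defs.pmf_sum1 p); apply: ler_sum => i _.
  rewrite -[leRHS]mulr1; apply: ler_wpM2l; first exact: Defs.pmf_ge0.
  rewrite /f; have := mass_ge0 p S; have := mass_le1 p S.
  rewrite -real_normK ?num_real// expr_le1// ler_norml.
  by case: (i \in S) => /= ? ?; apply/andP; split; lra.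
- move=> X; have -> : s%:R^-1 * \sum_(j < s) f (tnth X j)
      = advice_freq q phat X - mass p S.
    rewrite /f sumrB sumr_const card_ord mulrBr -[mass p S *+ s]mulr_natl.
    by rewrite mulKf// gt_eqF.
  move=> /noisy XO; rewrite -lee_fin /out_prob fineK; last first.
    exact: (@out_prob_fin_num _ _ _ (advice_test q phat alpha xi s)).
  apply: le_trans (laplace_prob_tail scale_gt0 t0).
  apply: le_measure; rewrite ?inE.
  + exact: (@run_measurable _ _ _ (advice_test q phat alpha xi s)).
  + exact: measurable_norm_gt.
  + by move=> w /XO.
(* With [s] at least 1000 times the rate, this is at most 64/1000, below 1/10. *)
have -> : (s%:R * (gap / 8) ^+ 2)^-1 + 4 * (1 / (s%:R * xi)) / (gap / 8)
    = (64 * (1 / gap ^+ 2) + 32 * (1 / (gap * xi))) / s%:R.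
  by field; rewrite !gt_eqF.
rewrite ler_pdivrMr//; move: ssz; rewrite /advice_rate.
have : 0 < 1 / gap ^+ 2 by rewrite divr_gt0// exprn_gt0.
have : 0 < 1 / (gap * xi) by rewrite divr_gt0// mulr_gt0.
lra.
Qed.

Lemma advice_test_correct (eps : R) :
  0 < gap -> 1000 * advice_rate gap xi <= s%:R ->
  private_augmented_identity_tester q phat xi eps alpha (1 / 10)
    (advice_test q phat alpha xi s).
Proof.
move=> gap0 ssz; split.
- exact: advice_test_private.
(* Rejection needs a total deviation above [gap / 4], of which sampling explains at most
   [gap / 8]. *)
- move=> p ->; apply: advice_test_error => // X w; rewrite /advice_run.
  case: ifPn => // + dev _; rewrite -/S -/gap => far.
  have := ler_normD (advice_freq q phat X - mass q S) w; rewrite addrAC; lra.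
- move=> p _; rewrite iid_prob_eq0 ?divr_ge0// => X w.
  by rewrite /= /advice_run; case: ifP.
(* Here [mass p S] lies at least [gap] below [mass q S], so landing within [gap / 4] takes noise of
   at least [5 * gap / 8]. *)
- move=> p p_phat; apply: advice_test_error => // X w; rewrite /advice_run.
  case: ifPn => //; rewrite -/S -/gap -leNgt => near dev _.
  have : gap + alpha <= mass q S - mass phat S by rewrite subrK dTV_attained.
  have := le_trans (mass_le_dTV p phat S) p_phat.
  rewrite ltNge; move: near dev; rewrite !ler_norml.
  move=> /andP[? ?] /andP[? ?] /andP[? ?] ?; apply/negP => /andP[? ?].
  lra.
Qed.

End advice_test_guarantees.

(** * The plain branch and the assembly of both branches *)

Lemma map_verdict_correct (R : realType) n (q phat : fdist R n)
    (xi eps alpha delta : R) (A : rand_alg R n bool) : 0 <= delta ->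
  private_identity_tester q xi eps delta A ->
  private_augmented_identity_tester q phat xi eps alpha delta
    (map_output verdict_of_bool A).
Proof.
move=> delta0 [privA complA soundA].
(* Relabelling is post-processing: every guarantee is read off on preimages of verdict sets, and
   [Bot] has no preimage. *)
have preim (O : set verdict) X :
    out_prob (A := map_output verdict_of_bool A) X O
    = out_prob (A := A) X (verdict_of_bool @^-1` O)%classic by [].
split.
- by move=> X X' XX' O; rewrite !preim; exact: privA.
- move=> p /complA; congr (_ <= _); apply: eq_bigr => X _; rewrite preim.
  by congr (_ * out_prob _ _); apply/seteqP; split=> b; case: b.
- move=> p /soundA; congr (_ <= _); apply: eq_bigr => X _; rewrite preim.
  by congr (_ * out_prob _ _); apply/seteqP; split=> b; case: b.
- by move=> p _; rewrite iid_prob_eq0// => X w /=; rewrite /map_run; case: (@run _ _ _ A X w).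
Qed.

Lemma plain_rate_ge0 (R : realType) n (eps xi : R) :
  0 < eps -> 0 < xi -> 0 <= plain_rate n eps xi.
Proof.
move=> e0 x0; rewrite /plain_rate !addr_ge0 ?divr_ge0 ?mulr_ge0 ?sqrtr_ge0//.
all: by rewrite ?powR_ge0 ?exprn_ge0 ?ltW.
Qed.

Theorem theorem7 (R : realType) :
  exists2 k0 : R, 0 < k0 &
  forall c C k K : R, 0 < c -> k0 <= k ->
  exists c' C' : R, [/\ 0 < c', 0 < C' &
    forall (T0 : plain_tester_family) (m : R -> R -> nat),
      plain_tester_spec c C T0 -> advice_size_spec k K m ->
    forall (n : nat) (q phat : fdist R n) (eps alpha xi : R),
      0 < eps <= 1 -> 0 <= alpha < 1 -> 0 < xi ->
      let A := augmented_tester T0 m q phat eps alpha xi in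
      private_augmented_identity_tester q phat xi eps alpha (1 / 10) A /\
      c' * augmented_rate n (dTV phat q) eps alpha xi <= (nsamples A)%:R
        <= C' * augmented_rate n (dTV phat q) eps alpha xi].
Proof.
exists 1000 => [|c C k K c0 k0]; first by rewrite ltr0n.
(* One pair of constants serves both branches; the 1 makes the upper one positive whatever the signs
   of [C] and [K]. *)
exists (Num.min c k), (Num.max 1 (Num.max C K)); split.
- by rewrite lt_min c0; lra.
- by rewrite lt_max ltr01.
move=> T0 m T0P mP n q phat eps alpha xi epsP alphaP xi0 A.
have P0 : 0 <= plain_rate n eps xi.
  by apply: plain_rate_ge0 => //; case/andP: epsP.
pose gap := dTV phat q - alpha.
have minL (r : R) : 0 <= r -> Num.min c k * r <= c * r.
  by move=> r0; rewrite ler_wpM2r// ge_min lexx.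
have minR (r : R) : 0 <= r -> Num.min c k * r <= k * r.
  by move=> r0; rewrite ler_wpM2r// ge_min lexx orbT.
have maxL (r : R) : 0 <= r -> C * r <= Num.max 1 (Num.max C K) * r.
  by move=> r0; rewrite ler_wpM2r// !le_max lexx !orbT.
have maxR (r : R) : 0 <= r -> K * r <= Num.max 1 (Num.max C K) * r.
  by move=> r0; rewrite ler_wpM2r// !le_max lexx !orbT.
rewrite /A /augmented_tester /augmented_rate; have [eta_le|eta_gt] /= := leP.
  have [T0c /andP[lo hi]] := T0P n q eps xi epsP xi0; split.
    by apply: map_verdict_correct => //; rewrite divr_ge0.
  by rewrite (le_trans (minL _ P0) lo) (le_trans hi (maxL _ P0)).
have gap0 : 0 < gap by rewrite subr_gt0.
(* The comparison that selects the branch also evaluates the minimum in the rate. *)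
have [plain_le|plain_gt] := leP.
  have [T0c /andP[lo hi]] := T0P n q eps xi epsP xi0; split.
    by apply: map_verdict_correct => //; rewrite divr_ge0.
  by rewrite (le_trans (minL _ P0) lo) (le_trans hi (maxL _ P0)).
have r0 : 0 < advice_rate gap xi.
  by rewrite addr_gt0// divr_gt0// ?mulr_gt0// exprn_gt0.
(* The specification of [m] covers only this range; the upper bound uses [dTV_le1] and
   [0 <= alpha]. *)
have gapP : 0 < gap <= 1.
  by rewrite gap0; have := dTV_le1 phat q; rewrite /gap; lra.
have /andP[lo hi] := mP gap xi gapP xi0.
have szP : 1000 * advice_rate gap xi <= (m gap xi)%:R.
  by apply: le_trans lo; rewrite ler_wpM2r// ltW.
split.
  apply: advice_test_correct => //; rewrite -(ltr0n R).
  by apply: lt_le_trans szP; rewrite mulr_gt0 ?ltr0n.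
by rewrite /= (le_trans (minR _ (ltW r0)) lo) (le_trans hi (maxR _ (ltW r0))).
Qed.
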